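(* Let $\Omega=(X_1\times\cdots\times X_n,\ \mu_1\times\cdots\times\mu_n)$ be a finite $n$-wise product probability space, let $(Z,d)$ be a pseudo-metric space, let $f,g:X_1\times\cdots\times X_n\to Z$, and let $\mathcal{T}$ be a randomized decision tree computing $f$. Then \[ \bigl|\mathbf{CoVr}[f,g]\bigr|\le\sum_{i=1}^n\delta_i(\mathcal{T})\,\mathbf{Inf}_i(g). \]
   Context: A pseudo-metric satisfies all metric axioms except possibly $d(z,z')=0\Rightarrow z=z'$. A deterministic decision tree (DDT) on $X=X_1\times\cdots\times X_n$ adaptively queries coordinates (each internal node labelled by a coordinate $i_v$, arcs in bijection with $X_{i_v}$, distinct labels on each root-leaf path, leaves labelled in $Z$), and computes $f$ if it outputs $f(x)$ on every input $x$. A randomized decision tree $\mathcal{T}$ computing $f$ is a probability distribution over DDTs each computing $f$. $\delta_i(\mathcal{T})$ is the probability, over $x\sim\mu$ and a DDT $T$ drawn from $\mathcal{T}$ independently, that $T$ queries $x_i$. $\mathbf{CoVr}[f,g]=\mathbf{E}_{x,y}[d(f(x),g(y))]-\mathbf{E}_x[d(f(x),g(x))]$ with $x,y$ independent samples from $\mu$. $\mathbf{Inf}_i(g)=\mathbf{E}[d(g(x),g(x^{(i)}))]$ where $x\sim\mu$ and $x^{(i)}$ is $x$ with its $i$th coordinate replaced by an independent sample from $\mu_i$. *)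

(* Defs.v *)
(* MathComp and MathComp-Analysis *)
From HB Require Import structures.
From mathcomp Require Import all_boot all_order all_algebra finmap.
From mathcomp Require Import boolp classical_sets functions cardinality fsbigop.
From mathcomp Require Import reals.

Set Implicit Arguments.
Unset Strict Implicit.
Unset Printing Implicit Defensive.

Import Order.TTheory GRing.Theory Num.Theory.
Local Open Scope ring_scope.

Record pseudometric (R : realType) (Z : Type) := Pseudometric {
  pdist :> Z -> Z -> R;
  pdist_ge0 : forall z z', 0 <= pdist z z';
  pdist_refl : forall z, pdist z z = 0;
  pdist_sym : forall z z', pdist z z' = pdist z' z;
  pdist_triangle : forall z1 z2 z3, pdist z1 z3 <= pdist z1 z2 + pdist z2 z3 }.

Record fin_prob (R : realType) (T : finType) := FinProb {
  fin_pmf :> T -> R;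
  fin_pmf_ge0 : forall a, 0 <= fin_pmf a;
  fin_pmf_sum1 : \sum_a fin_pmf a = 1 }.

(* The product set X_1 x ... x X_n; it is itself a finType. *)
Notation input X := {dffun forall i, X i}.

Section ProductSpace.
Context {R : realType} {n : nat} {X : 'I_n -> finType}.
Variable mu : forall i, fin_prob R (X i).

Definition prod_pmf (x : input X) : R := \prod_i mu i (x i).

Definition expect (F : input X -> R) : R := \sum_x prod_pmf x * F x.

(* x with its i-th coordinate replaced by a *)
Definition replace (x : input X) (i : 'I_n) (a : X i) : input X :=
  [ffun j => dfwith x a j].

Definition CoVr {Z : Type} (d : pseudometric R Z) (f g : input X -> Z) : R :=
  expect (fun x => expect (fun y => d (f x) (g y)))
  - expect (fun x => d (f x) (g x)).

Definition Inf {Z : Type} (d : pseudometric R Z) (i : 'I_n)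
    (g : input X -> Z) : R :=
  expect (fun x => \sum_(a : X i) mu i a * d (g x) (g (replace x a))).

End ProductSpace.

Section DecisionTrees.
Context {n : nat}.
Variables (X : 'I_n -> finType) (Z : Type).

Inductive dtree :=
  | Leaf of Z
  | Node (i : 'I_n) of (X i -> dtree).

(* No root-leaf path of t repeats a label or carries a label in used. *)
Fixpoint read_once (used : seq 'I_n) (t : dtree) : bool :=
  match t with
  | Leaf _ => true
  | Node i next => (i \notin used) && [forall a, read_once (i :: used) (next a)]
  end.

Record ddt := DDT { ddt_tree :> dtree; ddt_read_once : read_once [::] ddt_tree }.

HB.instance Definition _ := gen_eqMixin ddt.
HB.instance Definition _ := gen_choiceMixin ddt.

Fixpoint output (t : dtree) (x : input X) : Z :=
  match t with
  | Leaf z => z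
  | Node i next => output (next (x i)) x
  end.

Fixpoint queries (t : dtree) (x : input X) (i : 'I_n) : bool :=
  match t with
  | Leaf _ => false
  | Node j next => (j == i) || queries (next (x j)) x i
  end.

Definition computes (f : input X -> Z) (t : dtree) : Prop :=
  forall x, output t x = f x.

End DecisionTrees.

Arguments Leaf {n X Z} _.
Arguments Node {n X Z} i _.

Section RandomizedDecisionTrees.
Context {n : nat} {X : 'I_n -> finType} {Z : Type}.

(* A distribution supported on trees computing f. The sums over [set: ddt X Z]
   are finitely supported sums; this loses no generality, because only finitely
   many trees compute f as soon as the X_i are nonempty: see
   [finite_computing]. *)
Record rdt (R : realType) (f : input X -> Z) := RDT {
  rdt_pmf :> ddt X Z -> R;
  rdt_pmf_ge0 : forall t, 0 <= rdt_pmf t;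
  rdt_pmf_sum1 : \sum_(t \in [set: ddt X Z]%classic) rdt_pmf t = 1;
  rdt_computes : forall t, rdt_pmf t != 0 -> computes f t }.

(* delta_i(T): the probability that t queries x_i, for t drawn from T and x drawn
   from mu independently *)
Definition query_prob {R : realType} {f : input X -> Z}
    (mu : forall i, fin_prob R (X i)) (T : rdt R f) (i : 'I_n) : R :=
  \sum_(t \in [set: ddt X Z]%classic)
     T t * expect mu (fun x => (queries t x i)%:R).

End RandomizedDecisionTrees.

Section Finiteness.
Context {n : nat} {X : 'I_n -> finType} {Z : Type}.
Local Open Scope classical_set_scope.

Let finite_funs (A : finType) (T : Type) (B : set T) :
  finite_set B -> finite_set [set h : A -> T | forall a, B (h a)].
Proof.
move=> /(@finite_fsetP {classic T}) [s Bs].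
pose F (k : {ffun A -> s}) (a : A) : T := val (k a).
have Ffin : finite_set (F @` setT) by apply: finite_image; exact: finite_finset.
apply: sub_finite_set Ffin => h Bh.
have hs a : (h a : {classic T}) \in s by have := Bh a; rewrite Bs.
by exists [ffun a => FSetSub (hs a)] => //; apply/funext => a; rewrite /F ffunE.
Qed.

Fixpoint leaves_in (L : set Z) (t : dtree X Z) : Prop :=
  match t with
  | Leaf z => L z
  | Node i next => forall a, leaves_in L (next a)
  end.

Let finite_read_once (L : set Z) k : finite_set L ->
  finite_set [set t : dtree X Z | leaves_in L t /\ exists used : seq 'I_n,
    [/\ uniq used, (n <= size used + k)%N & read_once used t]].
Proof.
move=> Lfin; elim: k => [|k IHk].
  apply: sub_finite_set (finite_image Leaf Lfin) => -[z|i next] /= [Lt].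
    by move=> _; exists z.
  move=> [used [Uu]]; rewrite addn0 => le_n /andP[/negP[]].
  have /(uniq_min_size Uu) [|_ ->] : {subset used <= enum 'I_n}.
  - by move=> j _; rewrite mem_enum.
  - by rewrite size_enum_ord.
  by rewrite mem_enum.
set S := [set t | _] in IHk.
pose N (i : 'I_n) := Node i @` [set h : X i -> dtree X Z | forall a, S (h a)].
have Nfin : finite_set (\bigcup_i N i).
  apply: bigcup_finite => [|i _]; first exact: finite_finset.
  by apply: finite_image; apply: finite_funs.
have Ufin : finite_set (Leaf @` L `|` \bigcup_i N i).
  by rewrite finite_setU; split=> //; apply: finite_image.
apply: sub_finite_set Ufin => -[z|i next] /= [Lt [used [Uu le_n Rt]]]; [by left; exists z | right].
have /andP[iu /forallP Rnext] := Rt.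
exists i => //; exists next => // a; split; first exact: Lt.
by exists (i :: used); split; rewrite //= ?iu // addSnnS.
Qed.

Let leaves_in_computing (f : input X -> Z) (t : dtree X Z) (used : seq 'I_n)
    (x : input X) :
  read_once used t ->
  (forall y : input X, {in used, forall j, y j = x j} -> output t y = f y) ->
  leaves_in (range f) t.
Proof.
elim: t used x => [z|i next IH] used x /=;
  first by move=> _ fP; exists x; rewrite -?fP.
move=> /andP[iu /forallP Rnext] fP a.
apply: (IH a (i :: used) (replace x a)) => // y yx.
have ya : y i = a by rewrite yx ?mem_head// ffunE dfwith_in.
rewrite -fP ?ya// => j ju; rewrite yx ?inE ?ju ?orbT// ffunE dfwith_out//.
by apply: contraNneq iu => ->.
Qed.

Lemma finite_computing (f : input X -> Z) (x0 : input X) :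
  finite_set [set t : ddt X Z | computes f t].
Proof.
have finj : injective (@ddt_tree n X Z).
  by move=> [t p] [u q] /= E; case: u / E q => q; rewrite (bool_irrelevance p q).
have Tfin := @finite_read_once (range f) n (finite_image f finite_finset).
have : finite_set (@ddt_tree n X Z @` [set t : ddt X Z | computes f t]).
  apply: sub_finite_set Tfin => _ [[t Rt] /= tf <-]; split.
    by apply: (leaves_in_computing Rt (x := x0)) => y _; apply: tf.
  by exists [::].
by rewrite (eq_finite_set (inj_card_eq _))// => t u _ _ /finj.
Qed.

End Finiteness.

(* Main.v *)
(* Since CoVr[f, g] does not depend on the tree computing f, it suffices to treat
   one deterministic tree t, by induction on t. Let i be its root and t_a the
   subtree at the arc a. As t_a does not read x_i, both delta_j(t) and CoVr[t, g] are
   averages over a ~ mu_i of the same quantities for t_a, up to corrections: delta_j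
   gains 1 when j = i, and CoVr changes because g(x) becomes g(x^(i <- a)), which
   by the triangle inequality costs at most E[d(g(x), g(x^(i <- a)))]. The average
   of this cost over a is Inf_i(g). *)
Require Import Defs.
From mathcomp Require Import all_boot all_order all_algebra reals.
From mathcomp Require Import ring lra.
From mathcomp Require finmap boolp classical_sets fsbigop.
Import Order.TTheory GRing.Theory Num.Theory.
Local Open Scope ring_scope.

(** * Replacing one coordinate, and trees that do not read it *)

Section Replace.
Context {n : nat} {X : 'I_n -> finType}.
Implicit Types (x : input X) (i : 'I_n).

Lemma replace_in x i (a : X i) : replace x a i = a.
Proof. by rewrite ffunE dfwith_in. Qed.

Lemma replace_out x i (a : X i) j : i != j -> replace x a j = x j.
Proof. by move=> ij; rewrite ffunE dfwith_out. Qed.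

Lemma replace_replace x i (a b : X i) : replace (replace x b) a = replace x a.
Proof.
apply/ffunP => j; have [ij|ij] := eqVneq i j.
  by case: j / ij; rewrite !replace_in.
by rewrite !replace_out.
Qed.

Lemma replace_id x i : replace x (x i) = x.
Proof.
apply/ffunP => j; have [ij|ij] := eqVneq i j.
  by case: j / ij; rewrite replace_in.
by rewrite replace_out.
Qed.

Context {Z : Type}.
Implicit Types (t : dtree X Z) (used : seq 'I_n).

(** A label in [used] cannot occur in [t], so no step of the run looks at coordinate [i]. *)
Lemma output_replace {used t i} x (a : X i) :
  read_once used t -> i \in used -> output t (replace x a) = output t x.
Proof.
elim: t used => [//|j next IH] used /= /andP[ju /forallP Rnext] iu.
rewrite replace_out; last by apply: contraNneq ju => <-.
by rewrite (IH _ (j :: used)) // in_cons iu orbT.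
Qed.

Lemma queries_replace {used t i} x (a : X i) :
  read_once used t -> i \in used -> queries t (replace x a) =1 queries t x.
Proof.
elim: t used => [//|j next IH] used /= /andP[ju /forallP Rnext] iu k /=.
rewrite replace_out; last by apply: contraNneq ju => <-.
by rewrite (IH _ (j :: used)) // in_cons iu orbT.
Qed.

Lemma queries_used {used t i} x :
  read_once used t -> i \in used -> queries t x i = false.
Proof.
elim: t used => [//|j next IH] used /= /andP[ju /forallP Rnext] iu.
rewrite (IH _ (j :: used)) ?in_cons ?iu ?orbT // orbF.
by apply: contraNF ju => /eqP ->.
Qed.

End Replace.

(** * Expectation and resampling on the product space *)

Section Expectation.
Context {R : realType} {n : nat} {X : 'I_n -> finType}.
Variable mu : forall i, fin_prob R (X i).
Implicit Types (F G : input X -> R) (x : input X).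

Lemma prod_pmf_ge0 x : 0 <= prod_pmf mu x.
Proof. by apply: prodr_ge0 => i _; apply: fin_pmf_ge0. Qed.

Lemma prod_pmf_sum1 : \sum_x prod_pmf mu x = 1.
Proof.
rewrite (reindex (@dffun_of_fprod _ X)); last first.
  by apply: onW_bij; exact: dffun_of_fprod_bij.
transitivity (\sum_(t : fprod X) \prod_(i in 'I_n) [ffun a => mu i a] (t i)).
  by apply: eq_bigr => t _; apply: eq_bigr => i _; rewrite !ffunE.
rewrite big_fprod /=.
(* The default [0] of [untag] is never reached: the inner sum keeps only pairs tagged by [i]. *)
rewrite -(bigA_distr_big_dep (fun i => tagged_with X i)
  (fun i => untag 0 [ffun a => mu i a])) /=.
apply: big1 => i _; rewrite -(big_tag (fun i => [ffun a => mu i a])).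
by rewrite -[RHS](fin_pmf_sum1 (mu i)); apply: eq_bigr => a _; rewrite ffunE.
Qed.

Lemma eq_expect F G : F =1 G -> expect mu F = expect mu G.
Proof. by move=> FG; apply: eq_bigr => x _; rewrite FG. Qed.

Lemma expect_const (c : R) : expect mu (fun=> c) = c.
Proof. by rewrite /expect -mulr_suml prod_pmf_sum1 mul1r. Qed.

Lemma expectD F G : expect mu (fun x => F x + G x) = expect mu F + expect mu G.
Proof. by rewrite /expect -big_split; apply: eq_bigr => x _; rewrite mulrDr. Qed.

Lemma expectB F G : expect mu (fun x => F x - G x) = expect mu F - expect mu G.
Proof. by rewrite /expect -sumrB; apply: eq_bigr => x _; rewrite mulrBr. Qed.

Lemma expect_sum (I : finType) (c : I -> R) (F : I -> input X -> R) :
  expect mu (fun x => \sum_k c k * F k x) = \sum_k c k * expect mu (F k).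
Proof.
rewrite /expect; under eq_bigr do rewrite mulr_sumr.
rewrite exchange_big; apply: eq_bigr => k _.
by rewrite mulr_sumr; apply: eq_bigr => x _; rewrite mulrCA.
Qed.

Lemma le_norm_expect F G :
  (forall x, `|F x| <= G x) -> `|expect mu F| <= expect mu G.
Proof.
move=> FG; apply: (le_trans (ler_norm_sum _ _ _)); apply: ler_sum => x _.
by rewrite normrM (ger0_norm (prod_pmf_ge0 x)) ler_wpM2l ?prod_pmf_ge0.
Qed.

(** Only the factor at [i] changes; there is no division because [mu i] may vanish. *)
Lemma prod_pmf_replace x i (a : X i) :
  prod_pmf mu (replace x a) * mu i (x i) = prod_pmf mu x * mu i a.
Proof.
rewrite /prod_pmf (bigD1 i) //= [in RHS](bigD1 i) //= replace_in.
rewrite (eq_bigr (fun j => mu j (x j))); first by ring.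
by move=> j ji; rewrite replace_out // eq_sym.
Qed.

(* (x, a) |-> (replace x a, x i) is a weight-preserving involution *)
Lemma expect_resample i F :
  expect mu (fun x => \sum_(a : X i) mu i a * F (replace x a)) = expect mu F.
Proof.
rewrite /expect; under eq_bigr do rewrite mulr_sumr.
rewrite pair_bigA /=.
pose h (p : input X * X i) := (replace p.1 p.2, p.1 i).
have hK : involutive h.
  by move=> [x a]; rewrite /h /= replace_in replace_replace replace_id.
rewrite (reindex_inj (inv_inj hK)) /=.
transitivity (\sum_(p : input X * X i) prod_pmf mu p.1 * mu i p.2 * F p.1).
  apply: eq_bigr => -[x a] _ /=.
  by rewrite replace_replace replace_id mulrA prod_pmf_replace.
rewrite -(pair_bigA _ (fun x a => prod_pmf mu x * mu i a * F x)) /=.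
by apply: eq_bigr => x _; rewrite -mulr_suml -mulr_sumr fin_pmf_sum1 mulr1.
Qed.

(** This is conditioning on [x i]: as [H a] ignores coordinate [i], resampling that coordinate only
    affects the index of [H]. *)
Lemma expect_coord i (H : X i -> input X -> R) :
  (forall (a b : X i) x, H a (replace x b) = H a x) ->
  expect mu (fun x => H (x i) x) = \sum_a mu i a * expect mu (H a).
Proof.
move=> Hrep; rewrite -(expect_resample i) -expect_sum.
by apply: eq_expect => x; apply: eq_bigr => a _; rewrite replace_in Hrep.
Qed.

(** * Recursion at the root of a tree *)

Context {Z : Type}.
Variables (d : pseudometric R Z) (g : input X -> Z).

Lemma pdist_diff z z1 z2 : `|d z z1 - d z z2| <= d z1 z2.
Proof.
have := pdist_triangle d z z2 z1; have := pdist_triangle d z z1 z2.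
by rewrite (pdist_sym d z2 z1) ler_norml; lra.
Qed.

Lemma Inf_ge0 i : 0 <= Inf mu d i g.
Proof.
apply: sumr_ge0 => x _; rewrite mulr_ge0 ?prod_pmf_ge0 // sumr_ge0 // => a _.
by rewrite mulr_ge0 ?fin_pmf_ge0 ?pdist_ge0.
Qed.

Lemma InfE i :
  Inf mu d i g = \sum_a mu i a * expect mu (fun x => d (g x) (g (replace x a))).
Proof. exact: expect_sum. Qed.

Lemma CoVr_leaf (z : Z) : CoVr mu d (output (Leaf z)) g = 0.
Proof. by rewrite /CoVr /= expect_const subrr. Qed.

(** In the first term of the covariance [g] sees the independent sample [y], so conditioning on
    [x i] leaves it alone; in the second it turns [g x] into [g (replace x a)], whence the
    correction. *)
Lemma CoVr_node i (next : X i -> dtree X Z) used :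
  read_once used (Node i next) ->
  CoVr mu d (output (Node i next)) g =
  \sum_a mu i a * (CoVr mu d (output (next a)) g
    + expect mu (fun x => d (output (next a) x) (g x)
                          - d (output (next a) x) (g (replace x a)))).
Proof.
move=> /= /andP[iu /forallP Rnext].
have out (a b : X i) x : output (next a) (replace x b) = output (next a) x.
  by rewrite (output_replace _ _ (Rnext a)) ?mem_head.
rewrite /CoVr /=.
rewrite (expect_coord i
  (fun a x => expect mu (fun y => d (output (next a) x) (g y)))); last first.
  by move=> a b x; rewrite out.
(* Writing [g x] as [g (replace x (x i))] gives an integrand to which [expect_coord] applies. *)
rewrite [X in _ - X](_ : _ = \sum_a mu i a *
    expect mu (fun x => d (output (next a) x) (g (replace x a)))); last first.
  rewrite -expect_coord => [|a b x]; last by rewrite out replace_replace.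
  by apply: eq_expect => x; rewrite replace_id.
rewrite -sumrB; apply: eq_bigr => a _; rewrite expectB; ring.
Qed.

Lemma expect_queries_node i (next : X i -> dtree X Z) used j :
  read_once used (Node i next) ->
  expect mu (fun x => (queries (Node i next) x j)%:R) =
  (i == j)%:R + \sum_a mu i a * expect mu (fun x => (queries (next a) x j)%:R).
Proof.
move=> /= /andP[iu /forallP Rnext].
rewrite -(expect_coord i (fun a x => (queries (next a) x j)%:R)); last first.
  by move=> a b x; rewrite (queries_replace _ _ (Rnext a)) ?mem_head.
rewrite -[X in X + _]expect_const -expectD; apply: eq_expect => x.
(* If [j = i], no subtree reads [j] again, so the disjunction in [queries] is a sum of
   indicators. *)
have [<-|_] := eqVneq i j; last by rewrite add0r.
by rewrite (queries_used _ (Rnext _)) ?mem_head // addr0.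
Qed.

Lemma CoVr_dtree used (t : dtree X Z) : read_once used t ->
  `|CoVr mu d (output t) g| <=
  \sum_i expect mu (fun x => (queries t x i)%:R) * Inf mu d i g.
Proof.
elim: t used => [z|i next IH] used Rt.
  rewrite CoVr_leaf normr0; apply: sumr_ge0 => i _.
  by rewrite /= expect_const mul0r.
rewrite (CoVr_node _ _ _ Rt).
under [leRHS]eq_bigr => j _ do
  rewrite (expect_queries_node _ _ _ _ Rt) mulrDl.
(* The root indicator contributes exactly [Inf mu d i g], which is then split over the arcs. *)
rewrite big_split /= [X in _ <= X + _](bigD1 i) //= eqxx mul1r.
rewrite [X in _ <= _ + X + _]big1 ?addr0; last first.
  by move=> j; rewrite eq_sym => /negbTE ->; rewrite mul0r.
rewrite InfE; under [X in _ <= _ + X]eq_bigr do rewrite mulr_suml.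
rewrite exchange_big -big_split /=.
apply: (le_trans (ler_norm_sum _ _ _)); apply: ler_sum => a _.
under [X in _ <= _ + X]eq_bigr do rewrite -mulrA.
rewrite -mulr_sumr -mulrDr normrM (ger0_norm (fin_pmf_ge0 _ _)).
rewrite ler_wpM2l ?fin_pmf_ge0 // addrC (le_trans (ler_normD _ _)) //.
(* The correction at arc [a] is charged to its share of the influence, the rest to the induction
   hypothesis. *)
rewrite lerD //; first by apply: le_norm_expect => x; exact: pdist_diff.
by have /= /andP[_ /forallP Rnext] := Rt; apply: (IH _ _ (Rnext a)).
Qed.

End Expectation.

(** * Randomized trees as finite mixtures *)

Section FiniteSupport.
Import classical_sets fsbigop.
Local Open Scope classical_set_scope.

(** One list [s] serves for every [c], so the total mass and all query probabilities become sums
    over the same trees. *)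
Lemma rdt_finite_support {R : realType} {n : nat} {X : 'I_n -> finType}
    {Z : Type} {f : input X -> Z} (T : rdt R f) :
  exists s : seq (ddt X Z), forall c : ddt X Z -> R,
    \sum_(t \in [set: ddt X Z]) T t * c t = \sum_(t <- s) T t * c t.
Proof.
(* With infinite support the sum would be 0 by convention, not 1. *)
have := rdt_pmf_sum1 T; case: finite_supportP => [_|s _ sT _ _].
  by rewrite big_nil => /eqP; rewrite eq_sym oner_eq0.
by exists (finmap.enum_fset s) => c; apply: fsbigTE => t ts; rewrite sT ?mul0r.
Qed.

End FiniteSupport.

Theorem theorem5 (R : realType) (n : nat) (X : 'I_n -> finType)
    (mu : forall i : 'I_n, fin_prob R (X i))
    (Z : Type) (d : pseudometric R Z)
    (f g : input X -> Z) (T : rdt R f) :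
  `|CoVr mu d f g| <= \sum_(i < n) query_prob mu T i * Inf mu d i g.
Proof.
have [s sE] := rdt_finite_support T.
have s1 : \sum_(t <- s) T t = 1.
  transitivity (\sum_(t <- s) T t * 1).
    by under eq_bigr do rewrite -[T _]mulr1.
  rewrite -(sE (fun=> 1)) -[RHS](rdt_pmf_sum1 T).
  by apply: fsbigop.eq_fsbigr => t _; rewrite mulr1.
rewrite /query_prob; under eq_bigr do rewrite sE mulr_suml.
(* As the weights sum to 1, the left side is an average over [s] too, and the comparison is made
   tree by tree. *)
rewrite exchange_big -[leLHS]mul1r -[X in X * `|_|]s1 mulr_suml /=.
apply: ler_sum => t _; under eq_bigr do rewrite -mulrA.
(* A tree of weight 0 need not compute [f]. *)
rewrite -mulr_sumr; have [->|Tt] := eqVneq (T t) 0; first by rewrite !mul0r.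
rewrite ler_wpM2l ?rdt_pmf_ge0 //.
have -> : f = output t.
  by apply: boolp.funext => x; rewrite (rdt_computes Tt).
exact: CoVr_dtree (ddt_read_once t).
Qed.
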